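(* Let $k \geq 3$. There exist marked groups $\Gamma_k$ and $\Delta_k$ whose Cayley graphs are isomorphic (as graphs) such that (i) $\chi_B(F(2^{\Gamma_k})) = \chi(F(2^{\Gamma_k})) = \chi(F(2^{\Delta_k})) = \chi(\mathrm{Cay}(\Gamma_k)) = \chi(\mathrm{Cay}(\Delta_k)) = k$, and (ii) $\chi_B(F(2^{\Delta_k})) = k+1$.
   Context: A marked group is a pair $(\Gamma,S)$ where $\Gamma$ is a finitely generated group and $S\subset\Gamma$ is a finite symmetric generating set with $\mathrm{id}\notin S$. If $\Gamma$ acts freely by Borel automorphisms on a standard Borel space $X$, the graph $G(S,a)$ on $X$ joins distinct $x,y$ iff $s\cdot x=y$ for some $s\in S$. The Cayley graph $\mathrm{Cay}(\Gamma)$ is this graph for the left multiplication action of $\Gamma$ on itself. The left shift action of $\Gamma$ on $2^\Gamma$ (product topology) is $(g\cdot x)(h)=x(g^{-1}h)$; its free part is $F(2^\Gamma)=\{x\in 2^\Gamma : g\cdot x\neq x \text{ for all } g\neq \mathrm{id}\}$, and the shift graph, also denoted $F(2^\Gamma)$, is the graph $G(S,a)$ for the shift action restricted to $F(2^\Gamma)$. For a graph $G$, $\chi(G)$ is its chromatic number (least $k$ admitting a $k$-coloring, i.e. a map sending adjacent vertices to distinct colors); for a Borel graph on a standard Borel space, $\chi_B(G)$ is the least $k$ such that $G$ admits a Borel $k$-coloring. *)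

(* Defs.v *)
From HB Require Import structures.
From mathcomp Require Import all_boot.
From mathcomp Require Import boolp classical_sets functions cardinality.
From mathcomp Require Import topology measurable_structure.

Set Implicit Arguments.
Unset Strict Implicit.
Unset Printing Implicit Defensive.

Local Open Scope classical_set_scope.
Local Open Scope group_scope.

Record graph (V : Type) := Graph {
  adj :> V -> V -> Prop;
  adj_sym : forall x y, adj x y -> adj y x;
  adj_irr : forall x, ~ adj x x
}.

Definition graph_iso (V W : Type) (G : graph V) (H : graph W) : Prop :=
  exists2 f : V -> W, bijective f & forall x y, G x y <-> H (f x) (f y).

Definition coloring (V : Type) (G : graph V) (k : nat) (c : V -> 'I_k) : Prop :=
  forall x y, G x y -> c x <> c y.

(* The finite set of colors is discrete, so all of its subsets are Borel. *)
Definition borel_map (T : topologicalType) (k : nat) (c : T -> 'I_k) : Prop :=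
  forall A : set 'I_k, <<s @open T >> (c @^-1` A).

Definition colorable (V : Type) (G : graph V) (k : nat) : Prop :=
  exists c : V -> 'I_k, coloring G c.

Definition borel_colorable (T : topologicalType) (G : graph T) (k : nat) : Prop :=
  exists2 c : T -> 'I_k, coloring G c & borel_map c.

Definition is_least (P : nat -> Prop) (k : nat) : Prop :=
  P k /\ forall j, P j -> (k <= j)%N.

Definition chromatic_number (V : Type) (G : graph V) (k : nat) : Prop :=
  is_least (colorable G) k.

Definition borel_chromatic_number (T : topologicalType) (G : graph T) (k : nat)
  : Prop := is_least (borel_colorable G) k.

Record marked_group := MarkedGroup {
  mg_group :> groupType;
  gens : set mg_group;
  gens_finite : finite_set gens;
  gens_sym : forall s, gens s -> gens s^-1;
  gens_neq1 : ~ gens 1;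
  gens_generate : forall H : {pred mg_group},
    group_closed H -> gens `<=` [set` H] -> forall g, g \in H
}.

Record group_action (Gam : groupType) (X : Type) := GroupAction {
  act :> Gam -> X -> X;
  act1 : forall x, act 1 x = x;
  actM : forall g h x, act (g * h) x = act g (act h x)
}.

Section ActionGraph.
Variables (Gam : marked_group) (X : Type) (a : group_action Gam X).

Definition action_adj (x y : X) : Prop :=
  x <> y /\ exists2 s, gens s & a s x = y.

Lemma action_adj_sym x y : action_adj x y -> action_adj y x.
Proof.
move=> [xy [s Ss sxy]]; split; first exact: nesym.
by exists s^-1; [exact: gens_sym | rewrite -sxy -actM mulVg act1].
Qed.

Lemma action_adj_irr x : ~ action_adj x x.
Proof. by case. Qed.

Definition action_graph : graph X := Graph action_adj_sym action_adj_irr.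

End ActionGraph.

Definition left_mult (Gam : groupType) : group_action Gam Gam :=
  @GroupAction Gam Gam (fun g x => g * x) (@mul1g Gam)
    (fun g h x => esym (mulgA g h x)).

Definition Cay (Gam : marked_group) : graph Gam := action_graph (left_mult Gam).

Section Shift.
Variable Gam : groupType.

Notation X := (prod_topology (fun _ : Gam => bool)).

Definition shift_fun (g : Gam) (x : X) : X := fun h => x (g^-1 * h).

Lemma shift_fun1 x : shift_fun 1 x = x.
Proof. by apply/funext => h; rewrite /shift_fun invg1 mul1g. Qed.

Lemma shift_funM g h x : shift_fun (g * h) x = shift_fun g (shift_fun h x).
Proof. by apply/funext => k; rewrite /shift_fun invgM mulgA. Qed.

Definition shift : group_action Gam X := GroupAction shift_fun1 shift_funM.

Definition free_part : set X := [set x | forall g : Gam, g <> 1 -> shift g x <> x].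

Lemma shift_free g x : free_part x -> free_part (shift g x).
Proof.
move=> Fx h h1 e; apply: (Fx (g^-1 * h * g)).
  move=> e1; apply: h1.
  have -> : h = g * (g^-1 * h * g) * g^-1.
    by rewrite !mulgA mulgV mul1g -mulgA mulgV mulg1.
  by rewrite e1 mulg1 mulgV.
by rewrite !actM e -actM mulVg act1.
Qed.

(* As a type, [free_part] carries the library's subspace topology. *)
Definition free_shift_fun (g : Gam) (x : free_part) : free_part :=
  exist _ (shift g (val x)) (mem_set (@shift_free g _ (set_mem (valP x)))).

Lemma free_shift_fun1 x : free_shift_fun 1 x = x.
Proof. by apply: val_inj; exact: act1. Qed.

Lemma free_shift_funM g h x :
  free_shift_fun (g * h) x = free_shift_fun g (free_shift_fun h x).
Proof. by apply: val_inj; exact: actM. Qed.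

Definition free_shift : group_action Gam free_part :=
  GroupAction free_shift_fun1 free_shift_funM.

End Shift.

Arguments free_part Gam : clear implicits.

Definition shift_graph (Gam : marked_group) : graph (free_part Gam) :=
  action_graph (free_shift Gam).

(* Main.v *)
(* Both groups are extensions of Z = <t> by the cyclic group <a> of order k, with t
   commuting with a in Gam and inverting it in Del; besides the nontrivial powers of a
   the generators are the a^j t with j <> 0, 1 and their inverses. An a-orbit is a
   k-clique, and in a k-coloring of it and of its image under t, the color of a point
   must reappear at one of the two non-adjacent positions j = 0, 1; this leaves only
   two choices for the whole level. Hence a k-coloring transports the cyclic order of the
   colors along t, and in Del this order is reversed by t with respect to a: a Borel
   k-coloring would give a Borel set A with t A equal to its complement, which
   contradicts the Baire property. In Gam the phase of the coloring may advance by one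
   from a level to the next, and in Del one spare color allows any two colorings of
   distant levels to be joined by changing one vertex per level; in both cases the
   coloring is built between the points of a Borel maximal separated set of markers. *)
From HB Require Import structures.
From mathcomp Require Import all_boot all_order all_algebra zify.
From mathcomp Require Import boolp classical_sets functions cardinality.
From mathcomp Require Import topology measurable_structure.
Require Import Defs.

Set Implicit Arguments.
Unset Strict Implicit.
Unset Printing Implicit Defensive.

Import Order.TTheory GRing.Theory Num.Theory.

Local Open Scope classical_set_scope.
Local Open Scope group_scope.

(** * Borel sets of the free part *)

Section BorelSets.
Variable T : topologicalType.

Definition borel (A : set T) : Prop := <<s @open T >> A.

Lemma borelC A : borel A -> borel (~` A).
Proof. by move=> bA; rewrite -setTD; exact: sigma_algebraCD. Qed.

Lemma borel_open A : open A -> borel A.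
Proof. exact: sub_sigma_algebra. Qed.

Lemma borel_bigcup (I : countType) (F : I -> set T) :
  (forall i, borel (F i)) -> borel (\bigcup_i F i).
Proof.
move=> bF; have -> : \bigcup_i F i =
    \bigcup_n (if unpickle n is Some i then F i else set0).
  apply/seteqP; split => x.
    by move=> [i _ Fx]; exists (pickle i) => //; rewrite pickleK.
  by move=> [n _]; case: (unpickle n) => // i Fx; exists i.
apply: sigma_algebra_bigcup => n; case: (unpickle n) => [i|]; first exact: bF.
exact: sigma_algebra0.
Qed.

Lemma borel_bigcap (I : countType) (F : I -> set T) :
  (forall i, borel (F i)) -> borel (\bigcap_i F i).
Proof.
move=> bF; rewrite -[X in borel X]setCK setC_bigcap; apply: borelC.
by apply: borel_bigcup => i; exact: borelC.
Qed.

Lemma borelI A B : borel A -> borel B -> borel (A `&` B).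
Proof.
move=> bA bB; have -> : A `&` B = \bigcap_b (if b then A else B).
  apply/seteqP; split => [x [Ax Bx] [] //|x ABx].
  by split; [exact: (ABx true)|exact: (ABx false)].
by apply: borel_bigcap; case.
Qed.

Lemma borelU A B : borel A -> borel B -> borel (A `|` B).
Proof.
by move=> bA bB; rewrite -[_ `|` _]setCK setCU; apply: borelC; apply: borelI; exact: borelC.
Qed.

Lemma borel_cst (P : Prop) : borel [set _ | P].
Proof.
have [p|np] := pselect P.
  have -> : [set _ | P] = setT :> set T by apply/seteqP; split.
  by rewrite -setC0; apply: borelC; exact: sigma_algebra0.
have -> : [set _ | P] = set0 :> set T by apply/seteqP; split.
exact: sigma_algebra0.
Qed.

End BorelSets.

Lemma borel_preimage (T U : topologicalType) (f : T -> U) (A : set U) :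
  continuous f -> borel A -> borel (f @^-1` A).
Proof.
move=> fc; apply: (@smallest_sub _ _ (@open U) [set A | borel (f @^-1` A)]).
  split=> /=.
  - rewrite preimage_set0; exact: sigma_algebra0.
  - by move=> B bB; rewrite setTD preimage_setC; exact: borelC.
  - by move=> F bF; rewrite preimage_bigcup; apply: borel_bigcup.
by move=> O oO /=; apply: borel_open; apply: open_comp => // x _; exact: fc.
Qed.

(** * Open sets of the shift space and continuity of the action *)

Section ShiftTopology.
Variable G : groupType.
Notation X := (prod_topology (fun _ : G => bool)).

Lemma open_coord (g : G) (b : bool) : open [set x : X | x g = b].
Proof.
apply: (@open_comp _ _ (fun x : X => x g) [set b]); last exact: discrete_open.
by move=> x _; exact: (@proj_continuous G (fun=> bool) g).
Qed.

Lemma open_agree (F : seq G) (x : X) : open [set y : X | {in F, y =1 x}].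
Proof.
elim: F => [|g F IH].
  have -> : [set y : X | {in [::], y =1 x}] = setT by apply/seteqP; split.
  exact: openT.
have -> : [set y : X | {in g :: F, y =1 x}] =
    [set y : X | y g = x g] `&` [set y : X | {in F, y =1 x}].
  apply/seteqP; split => y /= yx.
    split; first by apply: yx; rewrite mem_head.
    by move=> h hF; apply: yx; rewrite inE hF orbT.
  by move=> h; rewrite inE => /predU1P[->|]; [exact: yx.1|exact: yx.2].
by apply: openI => //; exact: open_coord.
Qed.

Lemma open_cylinder (O : set X) : open O <->
  forall x, O x -> exists F : seq G, forall y : X, {in F, y =1 x} -> O y.
Proof.
split=> [[D Dsub <-] x [B DB Bx]|cO]; last first.
  have -> : O = \bigcup_(A in [set A | open A /\ A `<=` O]) A.
    apply/seteqP; split => x; last by move=> [A [_ AO]] /AO.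
    move=> /cO[F FO]; exists [set y : X | {in F, y =1 x}] => //.
    by split=> //; exact: open_agree.
  by apply: bigcup_open => A [].
have /= [S Ssub BE] := Dsub _ DB.
(* Each of the finitely many subbasic sets whose intersection is [B] restricts a single coordinate;
   [F] collects these coordinates. *)
suff [F FP] : exists F : seq G, forall y : X, {in F, y =1 x} ->
    forall A, A \in finmap.enum_fset S -> A y.
  exists F => y /FP yS; exists B => //; rewrite -BE => A AS; exact: yS.
have {DB BE Bx} Sx : forall A, A \in finmap.enum_fset S ->
    A x /\ exists g : G, exists U : set bool, A = [set y | U (y g)].
  move=> A AS; split; first by move: Bx; rewrite -BE => /(_ _ AS).
  have /= := Ssub _ AS; rewrite inE => -[g _ [U oU UA]].
  by exists g, U; rewrite -UA.
elim: (finmap.enum_fset S) Sx => [|A s IH] Sx; first by exists [::].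
have [F FP] : exists F : seq G, forall y : X, {in F, y =1 x} ->
    forall A, A \in s -> A y.
  by apply: IH => C Cs; apply: Sx; rewrite inE Cs orbT.
have [] := Sx A; first by rewrite inE eqxx.
move=> Ax [g [U AE]]; exists (g :: F) => y yx C.
rewrite inE => /predU1P[->|Cs]; last first.
  by apply: (FP y) => // h hF; apply: yx; rewrite inE hF orbT.
by move: Ax; rewrite AE /= yx // mem_head.
Qed.

Lemma shift_continuous (g : G) : continuous (shift G g : X -> X).
Proof.
apply/continuousP => O /open_cylinder cO; apply/open_cylinder => x /cO[F FO].
exists [seq g^-1 * h | h <- F] => y yx; apply: FO => h hF.
by apply: yx; apply/mapP; exists h.
Qed.

Lemma free_shift_continuous (g : G) : continuous (free_shift G g).
Proof.
apply/continuousP => _ [O oO <-]; exists (shift G g @^-1` O) => //.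
by apply: open_comp => // x _; exact: shift_continuous.
Qed.

Lemma borel_act (g : G) (A : set (free_part G)) :
  borel A -> borel [set x | A (free_shift G g x)].
Proof. by apply: borel_preimage; exact: free_shift_continuous. Qed.

Lemma borel_coord (g : G) (b : bool) : borel [set x : free_part G | val x g = b].
Proof. by apply: borel_open; exists [set x : X | x g = b] => //; exact: open_coord. Qed.

End ShiftTopology.

(** * Baire category in the shift space *)

Section Category.
Variable G : groupType.
Notation X := (prod_topology (fun _ : G => bool)).

(** The list may prescribe both values at one coordinate, and then the cylinder is empty; hence the
    nonemptiness conditions below. *)
Definition cyl (p : seq (G * bool)) : set X :=
  [set x | forall g b, (g, b) \in p -> x g = b].

Lemma cyl_cat p q x : cyl (p ++ q) x <-> cyl p x /\ cyl q x.
Proof.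
split=> [c|[cp cq] g b]; last by rewrite mem_cat => /orP[/cp|/cq].
by split=> g b gb; apply: c; rewrite mem_cat gb ?orbT.
Qed.

Definition translate (g : G) (p : seq (G * bool)) :=
  [seq (g^-1 * hb.1, hb.2) | hb <- p].

Lemma cyl_translate g p x : cyl (translate g p) x <-> cyl p (shift G g x).
Proof.
split=> [c h b hb|c h b /mapP[[h' b'] hb [-> ->]]]; last exact: c hb.
by apply: c; apply/mapP; exists (h, b).
Qed.

Definition nowhere_dense (N : set X) : Prop := forall p, cyl p !=set0 ->
  exists q, [/\ cyl q !=set0, cyl q `<=` cyl p & cyl q `<=` ~` N].

Definition meager (E : set X) : Prop :=
  exists2 N : nat -> set X, (forall n, nowhere_dense (N n)) & E `<=` \bigcup_n N n.

Lemma meager_sub E E' : E `<=` E' -> meager E' -> meager E.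
Proof. by move=> EE' [N nN E'N]; exists N => // x /EE'/E'N. Qed.

Lemma nowhere_dense_meager N : nowhere_dense N -> meager N.
Proof. by move=> nN; exists (fun=> N) => // x Nx; exists 0%N. Qed.

Lemma nowhere_dense0 : nowhere_dense set0.
Proof. by move=> p p0; exists p; split=> // x _. Qed.

Lemma meager0 : meager set0.
Proof. exact/nowhere_dense_meager/nowhere_dense0. Qed.

Lemma meager_bigcup (I : countType) (E : I -> set X) :
  (forall i, meager (E i)) -> meager (\bigcup_i E i).
Proof.
move=> mE; have /choice[N NP] i : exists N : nat -> set X,
    (forall n, nowhere_dense (N n)) /\ E i `<=` \bigcup_n N n.
  by have [N] := mE i; exists N.
exists (fun n => if (unpickle n : option (I * nat)) is Some (i, j)
                 then N i j else set0).
  by move=> n; case: unpickle => [[i j]|]; [exact: (NP i).1|exact: nowhere_dense0].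
move=> x [i _] /(NP i).2[j _ Nx].
by exists (pickle (i, j)) => //; rewrite pickleK.
Qed.

Lemma meagerU E E' : meager E -> meager E' -> meager (E `|` E').
Proof.
move=> mE mE'; apply: (@meager_sub _ (\bigcup_(b : bool) (if b then E else E'))).
  by move=> x [Ex|Ex]; [exists true|exists false].
by apply: meager_bigcup; case.
Qed.

Lemma meager_shift g E : meager E -> meager [set x | E (shift G g x)].
Proof.
move=> [N nN EN]; exists (fun n => [set x | N n (shift G g x)]); last first.
  by move=> x /EN[n _ Nx]; exists n.
move=> n p [x px].
have [|q [[y qy] qp qN]] := nN n (translate g^-1 p).
  by exists (shift G g x); apply/cyl_translate; rewrite -actM mulVg act1.
exists (translate g q); split.
- by exists (shift G g^-1 y); apply/cyl_translate; rewrite -actM mulgV act1.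
- move=> z /cyl_translate/qp/cyl_translate.
  by rewrite -actM mulVg act1.
- by move=> z /cyl_translate/qN.
Qed.

(** Nested nonempty cylinders, the next one avoiding [N n], have a common point, which escapes every
    [N n]. *)
Lemma baire p : cyl p !=set0 -> ~ meager (cyl p).
Proof.
move=> p0 [N nN pN].
have /choice[f fP] (nq : nat * seq (G * bool)) : exists q, cyl nq.2 !=set0 ->
    [/\ cyl q !=set0, cyl q `<=` cyl nq.2 & cyl q `<=` ~` N nq.1].
  have [/(nN nq.1)[q qP]|n0] := pselect (cyl nq.2 !=set0); first by exists q.
  by exists [::].
pose s := fix s n := if n is n'.+1 then f (n', s n') else p.
have s0 n : cyl (s n) !=set0.
  by elim: n => [//|n /(fP (n, s n))[]].
have sS n : cyl (s n.+1) `<=` cyl (s n).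
  by have [] := fP (n, s n) (s0 n).
have sle m n : (m <= n)%N -> cyl (s n) `<=` cyl (s m).
  elim: n => [|n IH]; first by rewrite leqn0 => /eqP->.
  rewrite leq_eqVlt => /predU1P[->//|]; rewrite ltnS => /IH h x /sS; exact: h.
(* Coordinates at which some stage prescribes [true] get [true], all others [false]. Two stages
   cannot disagree, since the later cylinder is nonempty and contained in the earlier one. *)
pose x : X := fun g => `[< exists n, (g, true) \in s n >].
have sx n : cyl (s n) x.
  move=> g [] gb; first by apply/asboolP; exists n.
  apply/asboolP => -[m gm]; have [y ys] := s0 (maxn m n).
  have := sle _ _ (leq_maxl m n) y ys _ _ gm.
  by rewrite (sle _ _ (leq_maxr m n) y ys _ _ gb).
have [n _ Nx] := pN _ (sx 0%N).
have [_ _] := fP (n, s n) (s0 n).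
by move=> /(_ x (sx n.+1)).
Qed.

Variable enum : nat -> G.
Hypothesis enum_surj : forall g, exists n, enum n = g.

(* The Baire property, phrased with cylinders: each cylinder contains one in
   which [A] is meager or comeager. *)
Definition decided (A : set (free_part G)) : Prop := forall p, cyl p !=set0 ->
  exists q, [/\ cyl q !=set0, cyl q `<=` cyl p &
    meager (cyl q `&` [set val f | f in A]) \/
    meager (cyl q `&` [set val f | f in ~` A])].

(** If [O] meets the cylinder, a smaller cylinder fits inside [O]; otherwise [O] is empty there. *)
Lemma decided_open (O : set (free_part G)) : open O -> decided O.
Proof.
move=> [U /open_cylinder oU <-] p p0.
have [[x [px Ux]]|pU] := pselect (cyl p `&` U !=set0).
  have [F FU] := oU _ Ux; exists (p ++ [seq (g, x g) | g <- F]).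
  have cF y : cyl [seq (g, x g) | g <- F] y <-> {in F, y =1 x}.
    split=> [c g gF|yx g b /mapP[h hF [-> ->]]]; last exact: yx.
    by apply: c; apply/mapP; exists g.
  split; first by exists x; apply/cyl_cat; split => //; exact/cF.
    by move=> y /cyl_cat[].
  right; apply: meager_sub meager0 => y [/cyl_cat[_ /cF/FU Uy] [f nUf fy]].
  by apply: nUf; rewrite /= /set_val /= fy.
exists p; split => //; left; apply: meager_sub meager0 => y [py [f Uf fy]].
by apply: pU; exists y; split => //; rewrite -fy.
Qed.

(** If some [A n] is comeager in a subcylinder, so is the union. Otherwise, for each [n], the
    cylinders in which [A n] is meager are dense in [cyl p], so [A n] there is covered by countably
    many meager pieces and a nowhere dense remainder. *)
Lemma decided_bigcup (A : nat -> set (free_part G)) :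
  (forall n, decided (A n)) -> decided (\bigcup_n A n).
Proof.
move=> dA p p0.
have [[n [q [q0 qp mq]]]|nq] := pselect (exists n q,
    [/\ cyl q !=set0, cyl q `<=` cyl p & meager (cyl q `&` [set val f | f in ~` A n])]).
  exists q; split => //; right; apply: meager_sub mq => x [qx [f fA fx]].
  by split => //; exists f => // Af; apply: fA; exists n.
exists p; split => //; left.
apply: (@meager_sub _ (\bigcup_n (cyl p `&` [set val f | f in A n]))).
  by move=> x [px [f [n _ Af] fx]]; exists n => //; split => //; exists f.
apply: meager_bigcup => n.
(* Coding cylinders by lists over [nat] makes the union of the meager pieces a countable one. *)
pose dec (c : seq (nat * bool)) := [seq (enum gb.1, gb.2) | gb <- c].
have decP q : exists c, dec c = q.
  elim: q => [|[g b] q [c <-]]; first by exists [::].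
  by have [m <-] := enum_surj g; exists ((m, b) :: c).
pose D (c : seq (nat * bool)) := meager (cyl (dec c) `&` [set val f | f in A n]).
apply: (@meager_sub _ ((\bigcup_c [set x | [/\ D c, cyl (dec c) x &
      [set val f | f in A n] x]]) `|`
    (cyl p `\` \bigcup_(c in D) cyl (dec c)))).
  move=> x [px Ax]; have [[c Dc cx]|nx] := pselect ((\bigcup_(c in D) cyl (dec c)) x).
    by left; exists c.
  by right.
apply: meagerU.
  apply: meager_bigcup => c; have [Dc|nDc] := pselect (D c).
    by apply: meager_sub Dc => x [].
  by apply: meager_sub meager0 => x [].
apply: nowhere_dense_meager => r r0.
have [rp|nrp] := pselect (cyl (r ++ p) !=set0); last first.
  exists r; split => // x rx [px _]; apply: nrp; exists x; exact/cyl_cat.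
have [q [q0 qrp [mq|mq]]] := dA n _ rp; last first.
  by case: nq; exists n, q; split => // x /qrp/cyl_cat[].
have [c cq] := decP q; exists q; split => //; first by move=> x /qrp/cyl_cat[].
by move=> x qx [_]; apply; exists c; rewrite /D ?cq.
Qed.

Lemma borel_decided (A : set (free_part G)) : borel A -> decided A.
Proof.
apply: (@smallest_sub _ _ _ decided); last by move=> O; exact: decided_open.
split.
- move=> p p0; exists p; split => //; left.
  by apply: meager_sub meager0 => x [_ []].
- move=> B dB p /dB[q [q0 qp]]; rewrite setTD => mq; exists q; split => //.
  by rewrite setCK; case: mq; [right|left].
- exact: decided_bigcup.
Qed.

Hypothesis infinite : forall F : seq G, exists g, g \notin F.

(** For [g <> 1] the points fixed by [g] form a nowhere dense set: any cylinder can be refined by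
    prescribing opposite values at some [h] and at [g^-1 * h]. *)
Lemma not_free_meager : meager (~` free_part G).
Proof.
exists (fun n => [set x | enum n <> 1 /\ shift G (enum n) x = x]); last first.
  move=> x /existsNP[g /not_implyP[g1 /contrapT gx]].
  by have [n ng] := enum_surj g; exists n => //=; rewrite ng.
move=> n p [x px]; set g := enum n.
have [g1|/eqP g1] := eqVneq g 1.
  by exists p; split => // [|y _ []//]; exists x.
pose F := [seq gb.1 | gb <- p].
(* Avoiding both [F] and its translate by [g] keeps [h] and [g^-1 * h] off the coordinates fixed by
   [p]. *)
have [h] := infinite (F ++ [seq g * f | f <- F]).
rewrite mem_cat => /norP[hF hgF].
have ghF : g^-1 * h \notin F.
  by apply: contra hgF => ghF; apply/mapP; exists (g^-1 * h); rewrite // mulVKg.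
have ghh : g^-1 * h != h.
  apply/eqP => e; apply: g1.
  by apply: invg_inj; apply: (@mulIg _ h); rewrite e invg1 mul1g.
exists ((h, true) :: (g^-1 * h, false) :: p); split.
- exists (fun u => if u == h then true else if u == g^-1 * h then false else x u).
  move=> u b; rewrite !inE => /or3P[/eqP[-> ->]|/eqP[-> ->]|ubp].
  + by rewrite eqxx.
  + by rewrite (negPf ghh) eqxx.
  + have uF : u \in F by apply/mapP; exists (u, b).
    have [uh|_] := eqVneq u h; first by rewrite uh (negPf hF) in uF.
    have [uh|_] := eqVneq u (g^-1 * h); first by rewrite uh (negPf ghF) in uF.
    exact: px.
- by move=> y yq u b ub; apply: yq; rewrite !inE ub !orbT.
- move=> y yq [_ /(congr1 (@^~ h))].
  rewrite (yq h true) ?mem_head // /shift /= /shift_fun -/g.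
  by rewrite (yq _ false) // !inE eqxx orbT.
Qed.

Lemma free_part_nonempty : exists x : free_part G, True.
Proof.
have [x xF] : exists x, free_part G x.
  apply: contrapT => nF; apply: (@baire [::]); first by exists (fun=> true).
  by apply: meager_sub not_free_meager => x _ xF; apply: nF; exists x.
by exists (exist _ x (mem_set xF)).
Qed.

(** Up to complement, [A] is meager in a cylinder [cyl q]. If [g] moves the support of [q] off
    itself, the points [x] with both [x] and [g x] in [cyl q] form a nonempty cylinder; one of [x],
    [g x] lies in [A], so this cylinder would be meager. *)
Lemma no_flipped_borel (A : set (free_part G)) : borel A ->
  (forall F : seq G, exists2 g, (forall h, h \in F -> g * h \notin F) &
    forall x, A (free_shift G g x) <-> ~ A x) -> False.
Proof.
wlog [q [q0 mq]] : A / exists q, cyl q !=set0 /\ meager (cyl q `&` [set val f | f in A]).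
  move=> H bA fA; have [|q [q0 _ [mq|mq]]] := borel_decided bA (p := [::]).
  - by exists (fun=> true).
  - by apply: (H A) => //; exists q.
  - apply: (H (~` A)).
    + by exists q.
    + exact: borelC.
    + move=> F; have [g gF gA] := fA F; exists g => // x; rewrite /setC /=.
      by split=> [nAg /gA//|nnA /gA].
move=> bA /(_ [seq gb.1 | gb <- q])[g gF gA].
apply: (@baire (q ++ translate g q)).
  have [x qx] := q0; exists (fun u => if u \in [seq gb.1 | gb <- q] then x u else x (g * u)).
  apply/cyl_cat; split=> u b; first by move=> ub; rewrite (map_f fst ub); exact: qx.
  move=> /mapP[[h b'] hb [-> ->]]; rewrite mulVKg /=.
  case: ifP => [guq|_]; last exact: qx.
  by have := gF _ guq; rewrite mulVKg (map_f fst hb).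
apply: meager_sub (meagerU (meagerU mq (meager_shift g mq)) not_free_meager).
move=> x /cyl_cat[qx /cyl_translate qgx].
have [xF|] := pselect (free_part G x); last by right.
pose f : free_part G := exist _ x (mem_set xF); left.
have [Af|nAf] := pselect (A f); first by left; split => //; exists f.
by right; split => //; exists (free_shift G g f) => //; exact/gA.
Qed.

End Category.

(** * Free orbits and Borel markers *)

Section FreePart.
Variable G : groupType.

Lemma free_shift_neq (x : free_part G) (g : G) : g <> 1 -> free_shift G g x <> x.
Proof. by move=> g1 /(congr1 val); exact: (set_mem (valP x)). Qed.

Lemma free_shift_inj (x : free_part G) (g h : G) :
  free_shift G g x = free_shift G h x -> g = h.
Proof.
move=> e; apply: contrapT => gh; apply: (@free_shift_neq x (h^-1 * g)).
  by move=> hg; apply: gh; rewrite -[g](mulVKg h) hg mulg1.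
by rewrite actM e -actM mulVg act1.
Qed.

Variable enum : nat -> G.
Hypothesis enum_surj : forall g, exists n, enum n = g.
Variable H : seq G.
Hypothesis H1 : 1 \notin H.
Hypothesis HV : forall h, h \in H -> h^-1 \in H.

(** The value of [h x] at a coordinate [u] is [x (h^-1 * u)]. Thus the code [c] names, for each [h]
    in [L], a coordinate where [x] and [h x] differ, together with the value of [x] there; there are
    only countably many codes. *)
Definition separated (L : seq G) (c : seq (nat * bool)) : set (free_part G) :=
  [set x | forall i, (i < size L)%N -> let mb := nth (0%N, false) c i in
    val x (enum mb.1) = mb.2 /\ val x ((nth 1 L i)^-1 * enum mb.1) = ~~ mb.2].

Lemma separated_borel L c : borel (separated L c).
Proof.
have -> : separated L c = \bigcap_(i : 'I_(size L))
    ([set x | val x (enum (nth (0%N, false) c i).1) = (nth (0%N, false) c i).2] `&`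
     [set x | val x ((nth 1 L i)^-1 * enum (nth (0%N, false) c i).1) =
       ~~ (nth (0%N, false) c i).2]).
  apply/seteqP; split=> [x xS i _|x xS i iL]; first exact: xS.
  exact: (xS (Ordinal iL)).
by apply: borel_bigcap => i; apply: borelI; exact: borel_coord.
Qed.

Lemma separated_disjoint L c h x : h \in L ->
  separated L c x -> ~ separated L c (free_shift G h x).
Proof.
move=> /(nthP 1)[i iL <-] /(_ i iL)[_ /= xh] /(_ i iL)[/= xh' _].
by move: xh'; rewrite /shift_fun xh; case: (nth _ _ _).2.
Qed.

Lemma separated_cover L x : 1 \notin L -> exists c, separated L c x.
Proof.
elim: L => [|h L IH]; first by exists [::] => -[].
rewrite inE => /norP[/eqP h1 /IH[c xc]].
have [g xg] : exists g, val x (h^-1 * g) <> val x g.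
  apply: contrapT => /forallNP xh; apply: (@free_shift_neq x h); first exact/nesym.
  by apply: val_inj; apply/funext => g; exact: contrapT (xh g).
have [m gm] := enum_surj g; exists ((m, val x g) :: c) => -[_|i iL] /=; last exact: xc.
rewrite gm; split=> //.
by rewrite /= in xg; case: (sval x (h^-1 * g)) (sval x g) xg => -[].
Qed.

(** Stage [n'] treats the separated set with code [n'] and adds those of its points that have no
    translate by [H] chosen so far. A number that decodes to nothing is read as the empty code,
    which still gives a separated set. *)
Fixpoint greedy (n : nat) : set (free_part G) :=
  if n is n'.+1 then
    greedy n' `|` (separated H (odflt [::] (unpickle n')) `&`
      ~` \bigcup_(i : 'I_(size H)) [set x | greedy n' (free_shift G (nth 1 H i) x)])
  else set0.

Lemma greedy_borel n : borel (greedy n).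
Proof.
elim: n => [|n IH] /=; first exact: sigma_algebra0.
apply: borelU => //; apply: borelI; first exact: separated_borel.
by apply: borelC; apply: borel_bigcup => i; exact: borel_act.
Qed.

Lemma greedy_mono m n : (m <= n)%N -> greedy m `<=` greedy n.
Proof.
elim: n => [|n IH]; first by rewrite leqn0 => /eqP->.
by rewrite leq_eqVlt => /predU1P[->//|/IH mn] x /mn; left.
Qed.

Lemma greedy_indep n h x : h \in H -> greedy n x -> ~ greedy n (free_shift G h x).
Proof.
elim: n h x => [//|n IH] h x hH /=.
have sub (k : G) y : k \in H -> greedy n (free_shift G k y) ->
    (\bigcup_(i : 'I_(size H)) [set x | greedy n (free_shift G (nth 1 H i) x)]) y.
  by move=> /(nthP 1)[i iH <-] gy; exists (Ordinal iH).
move=> [gx|[sx ngx]] [ghx|[shx nghx]].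
- exact: IH gx ghx.
- by apply: nghx; apply: (sub h^-1); [exact: HV|rewrite -actM mulVg act1].
- by apply: ngx; exact: sub ghx.
- exact: separated_disjoint sx shx.
Qed.

(** Independence holds at each stage and passes to the increasing union. For maximality, every point
    lies in a separated set, and the stage of its code adds it unless a translate was chosen
    earlier. *)
Lemma borel_marker : exists M : set (free_part G), [/\ borel M,
  (forall h x, h \in H -> M x -> ~ M (free_shift G h x)) &
  (forall x, M x \/ exists2 h, h \in H & M (free_shift G h x))].
Proof.
exists (\bigcup_n greedy n); split.
- by apply: borel_bigcup => n; exact: greedy_borel.
- move=> h x hH [m _ gm] [n _ gn]; apply: (greedy_indep (n := maxn m n) hH).
    exact: greedy_mono (leq_maxl m n) _ gm.
  exact: greedy_mono (leq_maxr m n) _ gn.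
- move=> x; have [c xc] := separated_cover x H1.
  have [[h hH hx]|nx] := pselect (exists2 h, h \in H & greedy (pickle c) (free_shift G h x)).
    by right; exists h => //; exists (pickle c).
  left; exists (pickle c).+1 => //; right; rewrite pickleK; split => // -[i _ gi].
  by apply: nx; exists (nth 1 H i) => //; exact: mem_nth.
Qed.

End FreePart.

(** * Transfer of colorings from the Cayley graph to the shift graph *)

(** A base point chosen in each orbit identifies the orbit with the group by freeness, and the
    coloring is copied along this identification. No definability is asked of the choice. *)
Lemma shift_colorable (Gam : marked_group) k :
  colorable (Cay Gam) k -> colorable (shift_graph Gam) k.
Proof.
move=> [col colP].
pose orb (x : free_part Gam) := [set y | exists g : Gam, free_shift Gam g x = y].
(* The choice depends on the orbit as a set, so all points of an orbit get the same base point;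
   [None] is the value for the empty set. *)
have /choice[f fP] (P : set (free_part Gam)) : exists o : option (free_part Gam),
    P !=set0 -> exists2 y, o = Some y & P y.
  by have [[y Py]|nP] := pselect (P !=set0); [exists (Some y); exists y|exists None].
have /choice[gam gamP] x : exists g : Gam, f (orb x) = Some (free_shift Gam g^-1 x).
  have [|y -> [g <-]] := fP (orb x); first by exists x; exists 1; exact: act1.
  by exists g^-1; rewrite invgK.
exists (col \o gam) => x y [_ [s Ss sxy]] /=.
have orbE : orb y = orb x.
  apply/seteqP; split=> z [g <-].
    by exists (g * s); rewrite actM sxy.
  by exists (g / s); rewrite -sxy -actM mulgVK.
have gamE : gam y = s * gam x.
  have e : (gam x)^-1 = (gam y)^-1 * s.
    by apply: (@free_shift_inj _ x); rewrite actM sxy; apply: Some_inj; rewrite -!gamP orbE.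
  by rewrite -[gam x]invgK e invgM invgK mulVKg.
apply: colP; split; last by exists s.
rewrite gamE => /esym/eqP; rewrite -[X in _ == X]mul1g => /eqP/mulIg s1.
by apply: (@gens_neq1 Gam); rewrite -s1.
Qed.

(** * The two marked groups *)

(* The pair [(i, n)] stands for a^i t^n in <a, t | a^(m+3) = 1, t a t^-1 = a^(+-1)>,
   with the sign [-] iff [e]. *)
Definition semidirect (e : bool) (m : nat) : Type := ('I_m.+3 * int)%type.

HB.instance Definition _ e m := Countable.on (semidirect e m).

Section SemidirectGroup.
Variables (e : bool) (m : nat).
Notation Z := 'I_m.+3.
Notation G := (semidirect e m).
Implicit Types (i j : Z) (n : int).

(** The exponent of [t^n a^i t^-n] as a power of [a]. *)
Definition twist n i : Z := if e && odd `|n|%N then (- i)%R else i.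

Lemma twist0 i : twist 0 i = i.
Proof. by rewrite /twist andbF. Qed.

Lemma twistD n n' i : twist (n + n')%R i = twist n (twist n' i).
Proof.
rewrite /twist; have -> : odd (absz (n + n')%R) = odd `|n|%N (+) odd `|n'|%N by lia.
by case: e => //=; case: (odd `|n|%N); case: (odd `|n'|%N); rewrite /= ?opprK.
Qed.

Lemma twistN n i : twist (- n)%R i = twist n i.
Proof. by rewrite /twist abszN. Qed.

Lemma twistK n : involutive (twist n).
Proof. by move=> i; rewrite /twist; case: (e && _); rewrite ?opprK. Qed.

Lemma twist_add n i j : twist n (i + j)%R = (twist n i + twist n j)%R.
Proof. by rewrite /twist; case: ifP => // _; rewrite opprD. Qed.

Lemma twist_opp n i : twist n (- i)%R = (- twist n i)%R.
Proof. by rewrite /twist; case: ifP. Qed.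

Lemma twist_at0 n : twist n 0%R = 0%R.
Proof. by rewrite /twist; case: ifP => // _; rewrite oppr0. Qed.

Definition sd_mul (x y : G) : G := ((x.1 + twist x.2 y.1)%R, (x.2 + y.2)%R).
Definition sd_one : G := (0%R, 0%R).
Definition sd_inv (x : G) : G := ((- twist x.2 x.1)%R, (- x.2)%R).

Lemma sd_mulA : associative sd_mul.
Proof.
by move=> x y z; rewrite /sd_mul /= twist_add twistD !addrA.
Qed.

Lemma sd_mul1g : left_id sd_one sd_mul.
Proof. by case=> i n; rewrite /sd_mul /= twist0 !add0r. Qed.

Lemma sd_mulg1 : right_id sd_one sd_mul.
Proof. by case=> i n; rewrite /sd_mul /= twist_at0 !addr0. Qed.

Lemma sd_mulVg : left_inverse sd_one sd_inv sd_mul.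
Proof. by case=> i n; rewrite /sd_mul /= twistN !addNr. Qed.

Lemma sd_mulgV : right_inverse sd_one sd_inv sd_mul.
Proof. by case=> i n; rewrite /sd_mul /= twist_opp twistK !addrN. Qed.

HB.instance Definition _ := isGroup.Build G sd_mulA sd_mul1g sd_mulg1 sd_mulVg sd_mulgV.

Lemma sd_mulE i j n n' :
  ((i, n) : G) * ((j, n') : G) = ((i + twist n j)%R, (n + n')%R) :> G.
Proof. by []. Qed.

Lemma sd_invE i n : ((i, n) : G)^-1 = ((- twist n i)%R, (- n)%R) :> G.
Proof. by []. Qed.

(** The generators of level 0 or 1; with their inverses they give all generators, so every edge can
    be read in a direction that does not lower the level. *)
Definition positive_gen (s : G) : Prop :=
  (s.2 = 0%R /\ s.1 != 0%R) \/ [/\ s.2 = 1%R, s.1 != 0%R & s.1 != 1%R].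

Definition sd_gens : set G := [set s | positive_gen s \/ positive_gen s^-1].

Lemma sd_gens_finite : finite_set sd_gens.
Proof.
apply: (@sub_finite_set _ _ [set` [seq ((i, n) : G) | i <- fintype.enum Z,
    n <- [:: 0%R; 1%R; (-1)%R] : seq int]]); last exact: finite_seq.
move=> [i n] s; apply: (allpairs_f (pair : Z -> int -> G)); first by rewrite mem_enum.
by case: s => [] [[/= n0 _]|[/= n0 _ _]]; rewrite !inE; lia.
Qed.

Lemma sd_gens_sym s : sd_gens s -> sd_gens s^-1.
Proof. by rewrite /sd_gens /= invgK => -[]; [right|left]. Qed.

Lemma sd_gens_neq1 : ~ sd_gens 1.
Proof.
by rewrite /sd_gens /= invg1 => -[] [[_]|[]] //=; rewrite eqxx.
Qed.

Lemma sd_gens_generate (H : {pred G}) : group_closed H ->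
  sd_gens `<=` [set` H] -> forall g, g \in H.
Proof.
move=> [H1 Hdiv] SH.
have HV x : x \in H -> x^-1 \in H by move=> xH; rewrite -[x^-1]mul1g; exact: Hdiv.
have HM x y : x \in H -> y \in H -> x * y \in H.
  by move=> xH yH; rewrite -[y]invgK; apply: Hdiv => //; exact: HV.
have Ha i : ((i, 0%R) : G) \in H.
  have [->|i0] := eqVneq i 0%R; first exact: H1.
  by apply: SH; left; left.
have Ht : ((0%R, 1%R) : G) \in H.
  (* Since [t] itself is not a generator, it is written as a^-2 (a^2 t); modulo [m.+3] the exponent
     2 differs from 0 and 1. *)
  have -> : ((0%R, 1%R) : G) = ((- (1 + 1)%R, 0)%R : G) * ((1 + 1, 1)%R : G).
    by rewrite sd_mulE twist0 addNr add0r.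
  apply: HM => //; apply: SH; left; right; split => //=.
have Hn n : ((0%R, n) : G) \in H.
  have Hpos (k : nat) : ((0%R, Posz k) : G) \in H.
    elim: k => [|k IH]; first exact: H1.
    have -> : ((0%R, Posz k.+1) : G) = ((0%R, 1%R) : G) * ((0%R, Posz k) : G).
      by rewrite sd_mulE twist_at0 addr0; congr pair; lia.
    exact: HM.
  case: n => k; first exact: Hpos.
  have -> : ((0%R, Negz k) : G) = ((0%R, Posz k.+1) : G)^-1.
    by rewrite sd_invE twist_at0 oppr0; congr pair; lia.
  exact: HV.
case=> i n; have -> : ((i, n) : G) = ((i, 0%R) : G) * ((0%R, n) : G).
  by rewrite sd_mulE twist_at0 addr0 add0r.
exact: HM.
Qed.

Definition sd_marked : marked_group :=
  MarkedGroup sd_gens_finite sd_gens_sym sd_gens_neq1 sd_gens_generate.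

Definition sd_enum (n : nat) : G := odflt (1 : G) (unpickle n : option G).

Lemma sd_enum_surj g : exists k : nat, sd_enum k = g.
Proof. by exists (pickle g); rewrite /sd_enum pickleK. Qed.

(** Multiplication by [t^n] raises levels by [n], which exceeds twice a bound on the levels in [F].
    Having all large [n] leaves room to pick an odd one later. *)
Lemma sd_translate_away (F : seq G) : exists N : nat, forall n : nat, (N <= n)%N ->
  forall h, h \in F -> ((0%R, Posz n) : G) * h \notin F.
Proof.
have [B FB] : exists B : nat, forall h, h \in F -> (`|h.2| <= B)%N.
  elim: F => [|h F [B FB]]; first by exists 0%N.
  exists (maxn B `|h.2|) => k; rewrite inE => /predU1P[->|/FB kB]; lia.
exists (B + B).+1 => n nB h /[dup] hF /FB hB; apply/negP => /FB /=.
by rewrite /mul /=; lia.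
Qed.

Lemma sd_infinite (F : seq G) : exists g, g \notin F.
Proof.
have [N NF] := sd_translate_away (1 :: F); exists (0%R, Posz N).
have := NF N (leqnn N) 1; rewrite mem_head mulg1 => /(_ isT).
by rewrite inE => /norP[].
Qed.

Lemma cay_adjE x y : Cay sd_marked x y <->
  positive_gen (y * x^-1) \/ positive_gen (x * y^-1).
Proof.
have -> : x * y^-1 = (y * x^-1)^-1 by rewrite invgM invgK.
split=> [[_ [s Ss /= <-]]|S]; first by rewrite mulgK.
split; last by exists (y * x^-1) => //=; rewrite mulgVK.
by move=> xy; apply: sd_gens_neq1; rewrite -(mulgV x) {1}xy.
Qed.

Lemma positive_divE (x y : G) : positive_gen (y * x^-1) <->
  (y.2 = x.2 /\ y.1 != x.1) \/
  [/\ y.2 = (x.2 + 1)%R, (y.1 - twist 1 x.1)%R != 0%R & (y.1 - twist 1 x.1)%R != 1%R].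
Proof.
case: x y => [i n] [j n']; rewrite sd_invE sd_mulE /positive_gen /= twist_opp.
have t0 : n' = n -> twist n' (twist n i) = i by move=> ->; rewrite twistK.
have t1 : n' = (n + 1)%R -> twist n' (twist n i) = twist 1 i.
  by move=> ->; rewrite addrC twistD twistK.
split=> -[[]|[]] nn'.
- have {}nn' : n' = n by lia.
  by rewrite t0 // subr_eq0; left.
- have {}nn' : n' = (n + 1)%R by lia.
  by rewrite t1 //; right.
- by rewrite t0 // subr_eq0 nn' subrr; left.
- by rewrite t1 // nn' addrAC subrr add0r; right.
Qed.

End SemidirectGroup.

(** * The isomorphism between the two Cayley graphs *)

Section CayleyIsomorphism.
Variable m : nat.
Notation Z := 'I_m.+3.

(* Chosen so that consecutive values sum to [1] at even [n] and to [0] at odd [n],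
   which aligns the non-edges between levels [n] and [n + 1] of the two graphs. *)
Definition offset (n : int) : Z :=
  if odd `|n|%N then ((n %/ 2)%Z + 1)%R%:~R%R else (- (n %/ 2)%Z%:~R)%R.

Lemma offsetD (n : int) :
  (offset (n + 1) + offset n)%R = if odd `|n|%N then 0%R else 1%R.
Proof.
rewrite /offset; have -> : odd (absz (n + 1)%R) = ~~ odd `|n|%N by lia.
case: (boolP (odd _)) => on /=.
  have -> : ((n + 1)%R %/ 2)%Z = ((n %/ 2)%Z + 1)%R by lia.
  by rewrite addNr.
have -> : ((n + 1)%R %/ 2)%Z = (n %/ 2)%Z by lia.
by rewrite intrD addrAC subrr add0r.
Qed.

(** The excluded positions between consecutive levels have constant difference of exponents in the
    untwisted graph and constant sum in the twisted one; reflecting the odd levels turns differences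
    into sums up to sign. *)
Definition sd_untwist (x : semidirect false m) : semidirect true m :=
  ((twist true x.2 x.1 + offset x.2)%R, x.2).

Lemma cayley_iso : graph_iso (Cay (sd_marked false m)) (Cay (sd_marked true m)).
Proof.
exists sd_untwist.
  exists (fun x => (twist true x.2 (x.1 - offset x.2)%R, x.2)) => -[i n];
    rewrite /sd_untwist /=; first by rewrite addrK twistK.
  by rewrite twistK subrK.
have key (x y : semidirect false m) :
    @positive_gen false m (y * x^-1) <->
    @positive_gen true m (sd_untwist y * (sd_untwist x)^-1).
  rewrite !positive_divE; case: x y => [i n] [j n'] /=.
  have tF (u : Z) : twist false 1 u = u by [].
  have tT (u : Z) : twist true 1 u = (- u)%R by [].
  rewrite tF tT opprK.
  have E0 : n' = n -> ((twist true n' j + offset n')%R ==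
      (twist true n i + offset n)%R) = (j == i).
    move=> ->; rewrite (inj_eq (addIr _)).
    exact/inj_eq/inv_inj/twistK.
  (* The excluded pair 0, 1 is preserved by [d => d] and by [d => 1 - d], which are the two
     cases. *)
  have E1 : n' = (n + 1)%R -> (twist true n' j + offset n' +
      (twist true n i + offset n))%R = (if odd `|n|%N then j - i else 1 - (j - i))%R.
    move=> ->; rewrite addrACA offsetD [(n + 1)%R]addrC twistD tT /twist /=.
    by case: (odd _); rewrite ?opprK ?addr0 // opprB [RHS]addrC [(- j + i)%R]addrC.
  split=> -[[nn' ij]|[nn' d0 d1]].
  - by left; rewrite E0.
  - right; split => //; rewrite E1 //; case: ifP => // _.
      by rewrite subr_eq0 eq_sym.
    by rewrite -[X in _ != X]addr0 (inj_eq (addrI _)) oppr_eq0.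
  - by left; rewrite E0 in ij.
  - right; move: d0 d1; rewrite E1 //; case: ifP => // _.
    by rewrite subr_eq0 eq_sym -[X in _ -> _ != X -> _]addr0 (inj_eq (addrI _)) oppr_eq0.
move=> x y; rewrite !cay_adjE; split=> -[/key|/key]; by [left|right].
Qed.

End CayleyIsomorphism.

(** * Clique lower bounds and colorings of the Cayley graphs *)

Section Chromatic.
Variables (e : bool) (m : nat).
Notation Z := 'I_m.+3.
Notation G := (sd_marked e m).

Lemma clique_bound (X : Type) (a : group_action G X) (x : X) k :
  (forall g h : G, a g x = a h x -> g = h) -> colorable (action_graph a) k ->
  (m.+3 <= k)%N.
Proof.
move=> xfree [c cP].
pose f (i : Z) := c (a ((i, 0%R) : G) x).
have : injective f.
  move=> i j fij; apply/eqP/negP => ij.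
  apply: (cP (a ((i, 0%R) : G) x) (a ((j, 0%R) : G) x)) => //; split.
    by move=> /xfree[] ij'; apply: ij; rewrite ij'.
  exists (((j - i)%R, 0%R) : G).
    by left; left; split => //=; rewrite subr_eq0 eq_sym; exact/negP.
  by rewrite -actM sd_mulE twist0 subrK addr0.
by move=> /leq_card; rewrite !card_ord.
Qed.

Lemma cay_lower k : colorable (Cay G) k -> (m.+3 <= k)%N.
Proof.
by apply: (@clique_bound _ (left_mult G) 1) => g h /=; rewrite !mulg1.
Qed.

Lemma shift_lower k : colorable (shift_graph G) k -> (m.+3 <= k)%N.
Proof.
have [x _] := free_part_nonempty (@sd_enum_surj e m) (@sd_infinite e m).
by apply: (@clique_bound _ (free_shift G) x) => g h; exact: free_shift_inj.
Qed.

End Chromatic.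

(** When [t] commutes with [a], every generator changes the exponent of [a], so this exponent is a
    coloring. *)
Lemma cay_untwisted_colorable m : colorable (Cay (sd_marked false m)) m.+3.
Proof.
exists (fun x => x.1) => x y /cay_adjE.
have tF (u : 'I_m.+3) : twist false 1 u = u by [].
have key (u v : semidirect false m) : positive_gen (v * u^-1) -> u.1 <> v.1.
  rewrite positive_divE tF => -[[_ /eqP/nesym//]|[_ d0 _] uv].
  by rewrite uv subrr eqxx in d0.
by move=> [/key|/key/nesym].
Qed.

Lemma graph_iso_colorable (V W : Type) (G : graph V) (H : graph W) k :
  graph_iso G H -> colorable G k -> colorable H k.
Proof.
move=> [f [g fK gK] fP] [c cP]; exists (c \o g) => x y xy /=.
by apply: cP; apply/fP; rewrite !gK.
Qed.

Lemma borel_colorable_colorable (T : topologicalType) (G : graph T) k :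
  borel_colorable G k -> colorable G k.
Proof. by move=> [c cP _]; exists c. Qed.

(* A [k]-coloring lists each [a]-orbit in a cyclic order which [t] reverses. *)
Section TwistedLowerBound.
Variable m : nat.
Notation Z := 'I_m.+3.
Notation G := (sd_marked true m).
Variable c : free_part G -> Z.
Hypothesis cP : coloring (shift_graph G) c.
Hypothesis bc : borel_map c.

Definition level_color (x : free_part G) (i : Z) : Z := c (free_shift G ((i, 0%R) : G) x).
Definition up (x : free_part G) := free_shift G ((0%R, 1%R) : G) x.

Lemma level_color_neq (s : G) x : positive_gen s -> c (free_shift G s x) <> c x.
Proof.
move=> sP; apply/nesym; apply: cP; split; last by exists s => //; left.
apply/nesym/free_shift_neq => s1; apply: (@sd_gens_neq1 true m).
by rewrite -s1; left.
Qed.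

Lemma level_color_inj x : injective (level_color x).
Proof.
move=> i j ij; apply/eqP/negP => nij.
apply: (@level_color_neq (((i - j)%R, 0%R) : G) (free_shift G ((j, 0%R) : G) x)).
  by left; split => //=; rewrite subr_eq0; exact/negP.
by rewrite -actM sd_mulE twist0 subrK addr0.
Qed.

Lemma level_color_surj x u : exists i, level_color x i = u.
Proof.
have [g _ gK] := injF_bij (@level_color_inj x).
by exists (g u).
Qed.

(** All colors occur on the orbit of [up x]. The point a^j t x equals (a^(j+i) t)(a^i x), hence is
    adjacent to a^i x unless [j + i] is 0 or 1. *)
Lemma level_color_up x i :
  level_color x i = level_color (up x) (- i)%R \/
  level_color x i = level_color (up x) (1 - i)%R.
Proof.
have [j ju] := level_color_surj (up x) (level_color x i).
have [j0|j0] := eqVneq (j + i)%R 0%R.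
  by left; rewrite -ju; congr level_color; apply/eqP; rewrite -addr_eq0 j0.
have [j1|j1] := eqVneq (j + i)%R 1%R.
  by right; rewrite -ju; congr level_color; rewrite -j1 addrK.
exfalso; apply: (@level_color_neq (((j + i)%R, 1%R) : G) (free_shift G ((i, 0%R) : G) x)).
  by right.
rewrite -[RHS]/(level_color x i) -ju /level_color /up -!actM.
by rewrite !sd_mulE twist0 !addr0 add0r [twist _ _ _]/(- i)%R addrK.
Qed.

(** The choice between 0 and 1 is uniform in [i]: if [i] uses 0 and [i + 1] uses 1, both colors sit
    at position [- i], against injectivity. So once 0 occurs it propagates around the cycle. *)
Lemma level_color_reverse x : exists r,
  forall i, level_color (up x) i = level_color x (r - i)%R.
Proof.
suff [r rP] : exists r, forall i, level_color x i = level_color (up x) (r - i)%R.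
  by exists r => i; rewrite rP opprB addrC subrK.
have [[i0 i0P]|no] := pselect (exists i0, level_color x i0 = level_color (up x) (- i0)%R);
    last first.
  by exists 1%R => i; case: (level_color_up x i) => // ii; case: no; exists i.
exists 0%R => i; rewrite sub0r.
suff H (k : nat) : level_color x (i0 + k%:R)%R = level_color (up x) (- (i0 + k%:R))%R.
  by have := H (i - i0)%R; rewrite natr_Zp addrC subrK.
elim: k => [|k IH]; first by rewrite addr0.
case: (level_color_up x (i0 + k.+1%:R)%R) => //.
have -> : (1 - (i0 + k.+1%:R))%R = (- (i0 + k%:R))%R :> Z.
  by rewrite -natr1 addrA opprD [LHS]addrC subrK.
rewrite -IH => /level_color_inj/addrI/eqP.
by rewrite -natr1 -subr_eq0 addrAC subrr add0r oner_eq0.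
Qed.

(** The cyclic order of the colors is read off at color 0, by comparing the colors of its two
    neighbors along [a]. *)
Definition clockwise : set (free_part G) := [set x | exists i,
  level_color x i = 0%R /\ (level_color x (i + 1)%R < level_color x (i - 1)%R)%N].

Lemma clockwise_up x : clockwise (up x) <-> ~ clockwise x.
Proof.
have [r rP] := level_color_reverse x.
have [i ix] := level_color_surj x 0%R.
have cx : clockwise x <-> (level_color x (i + 1)%R < level_color x (i - 1)%R)%N.
  split=> [[j [jx lt]]|lt]; last by exists i.
  by move: jx lt; rewrite -ix => /level_color_inj ->.
have cu : clockwise (up x) <-> (level_color x (i - 1)%R < level_color x (i + 1)%R)%N.
  split=> [[j []]|lt].
    rewrite !rP -ix => /level_color_inj <-.
    by rewrite opprD opprB !addrA [(r + 1 - j)%R]addrAC.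
  exists (r - i)%R; rewrite !rP.
  have -> : (r - (r - i))%R = i by rewrite opprB addrC subrK.
  split => //.
  have -> : (r - (r - i + 1))%R = (i - 1)%R by rewrite opprD opprB addrA [(r + _)%R]addrC subrK.
  by have -> : (r - (r - i - 1))%R = (i + 1)%R
    by rewrite opprB opprB [LHS]addrC -addrA subrK addrC.
(* The two neighbors are distinct because 2 is nonzero modulo [m.+3]. *)
have neq : level_color x (i - 1)%R != level_color x (i + 1)%R :> nat.
  apply/negP => /eqP/val_inj/level_color_inj/addrI/eqP.
  by rewrite -subr_eq0 -opprD oppr_eq0.
by rewrite cx cu ltn_neqAle neq /= leqNgt; split => /negP.
Qed.

Lemma clockwise_borel : borel clockwise.
Proof.
have -> : clockwise = \bigcup_(i : Z) \bigcup_(u : Z) \bigcup_(v : Z)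
    ([set x | level_color x i = 0%R] `&` [set x | (u < v)%N] `&`
     ([set x | level_color x (i + 1)%R = u] `&` [set x | level_color x (i - 1)%R = v])).
  apply/seteqP; split=> x.
    move=> [i [i0 lt]]; exists i => //; exists (level_color x (i + 1)%R) => //.
    by exists (level_color x (i - 1)%R).
  by move=> [i _ [u _ [v _ [[i0 uv] [/= iu iv]]]]]; exists i; rewrite iu iv.
have bl i u : borel [set x | level_color x i = u].
  by apply: (@borel_act G (i, 0%R) [set x | c x = u]); exact: (bc [set u]).
do 3!apply: borel_bigcup => ?; apply: borelI; apply: borelI => //.
exact: borel_cst.
Qed.

Lemma no_borel_coloring : False.
Proof.
apply: (no_flipped_borel (@sd_enum_surj true m) (@sd_infinite true m) clockwise_borel).
move=> F; have [N NF] := sd_translate_away F.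
(* An odd power of [t] flips [clockwise], and this one is at least [N], so it also moves [F] off
   itself. *)
exists ((0%R, Posz N.*2.+1) : G).
  by apply: NF; lia.
move=> x; elim: N {NF} => [|N IH]; first exact: clockwise_up.
have -> : ((0%R, Posz N.+1.*2.+1) : semidirect true m) =
    ((0%R, 1%R) : semidirect true m) * (((0%R, 1%R) : semidirect true m) *
      ((0%R, Posz N.*2.+1) : semidirect true m)).
  by rewrite [X in _ * X]sd_mulE sd_mulE !(twist_at0, addr0).
rewrite !actM clockwise_up clockwise_up.
by split=> [/contrapT/IH|/IH ux nux].
Qed.

End TwistedLowerBound.

(** * Coloring between markers *)

Section Strips.
Variables (e : bool) (m K : nat).
Notation Z := 'I_m.+3.
Notation G := (sd_marked e m).

(* Colors the levels [0], ..., [L] between two consecutive markers [r] and a^i' t^L r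
   so that the colorings of both marker levels, seen from their marker, are [c0]. *)
Definition strip_coloring (c0 : Z -> 'I_K) (i' : Z) (L : nat)
    (psi : Z -> nat -> 'I_K) : Prop :=
  [/\ forall i, psi i 0%N = c0 i, forall i, psi (i + i')%R L = c0 i,
      forall n, (n <= L)%N -> injective (psi^~ n)
    & forall n i j, (n < L)%N -> j != 0%R -> j != 1%R ->
        psi i n <> psi (j + twist e 1 i)%R n.+1].

Variables (N : nat) (c0 : Z -> 'I_K) (psi : Z -> nat -> Z -> nat -> 'I_K).
Hypothesis psiP : forall i' L, (N < L)%N -> strip_coloring c0 i' L (psi i' L).

Lemma level_mul (g h : G) : (g * h).2 = (g.2 + h.2)%R. Proof. by []. Qed.
Lemma mul_fst (g h : G) : (g * h).1 = (g.1 + twist e g.2 h.1)%R. Proof. by []. Qed.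
Lemma level_inv (g : G) : (g^-1).2 = (- g.2)%R. Proof. by []. Qed.

(** Markers independent for this set are more than [N] levels apart within an orbit; in particular a
    level carries at most one. *)
Definition near_levels : seq G :=
  [seq g <- [seq ((i, (Posz a - Posz N)%R) : semidirect e m) |
      i <- fintype.enum Z, a <- iota 0 N.*2.+1] | g != 1].

Lemma mem_near_levels (g : G) : (g \in near_levels) = (g != 1) && (`|g.2| <= N)%N.
Proof.
rewrite mem_filter; congr (_ && _); apply/allpairsP/idP.
  by move=> [[i a] [_ aN ->]]; move: aN; rewrite mem_iota /=; lia.
case: g => [i n] /= nN; exists (i, absz (n + Posz N)%R).
split; first by rewrite mem_enum.
  by rewrite -[0%N :: _]/(iota 0 N.*2.+1) mem_iota /=; lia.
by congr pair; rewrite /=; lia.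
Qed.

Variable M : set (free_part G).
Hypothesis M_borel : borel M.
Hypothesis M_indep : forall h x, h \in near_levels -> M x -> ~ M (free_shift G h x).
Hypothesis M_max : forall x, M x \/ exists2 h, h \in near_levels & M (free_shift G h x).

Lemma marker_uniq (x : free_part G) (g h : G) : M (free_shift G g x) ->
  M (free_shift G h x) -> (`|(h.2 - g.2)%R| <= N)%N -> g = h.
Proof.
move=> Mg Mh gh; apply: contrapT => ngh.
apply: (@M_indep (h * g^-1) (free_shift G g x)) => //.
  rewrite mem_near_levels level_mul level_inv gh andbT.
  by apply/eqP => hg; apply: ngh; rewrite -[h](mulgVK g) hg mul1g.
by rewrite -actM mulgVK.
Qed.

Lemma marker_near (x : free_part G) :
  exists2 g : G, (`|g.2| <= N)%N & M (free_shift G g x).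
Proof.
have [Mx|[g]] := M_max x; first by exists 1; rewrite ?act1.
by rewrite mem_near_levels => /andP[_ gN]; exists g.
Qed.

(** Here [g] carries the marker to [x]. Level 0 is allowed, so all points on the level of a marker
    belong to the strip starting there. *)
Definition left_marker (x : free_part G) (g : G) : Prop :=
  [/\ (0 <= g.2)%R, M (free_shift G g^-1 x) &
      forall h : G, (0 <= h.2 < g.2)%R -> ~ M (free_shift G h^-1 x)].

Definition next_marker (r : free_part G) (g : G) : Prop :=
  [/\ (0 < g.2)%R, M (free_shift G g r) &
      forall h : G, (0 < h.2 < g.2)%R -> ~ M (free_shift G h r)].

Lemma min_level (P : set G) (b : int) : P !=set0 -> (forall g, P g -> (b <= g.2)%R) ->
  exists2 g, P g & forall h : G, P h -> (g.2 <= h.2)%R.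
Proof.
move=> [g0 Pg0] Pb.
pose Q (n : nat) := `[< exists2 g, P g & g.2 = (b + Posz n)%R >].
have exQ : exists n, Q n.
  by exists (absz (g0.2 - b)%R); apply/asboolP; exists g0 => //; have := Pb _ Pg0; lia.
case: (ex_minnP exQ) => n /asboolP[g Pg gn] nmin; exists g => // h Ph.
have := nmin (absz (h.2 - b)%R); have := Pb _ Ph => bh.
have Qh : Q (absz (h.2 - b)%R) by apply/asboolP; exists h => //; lia.
by move=> /(_ Qh); lia.
Qed.

Lemma left_marker_ex x : exists g, left_marker x g.
Proof.
(* A marker within [N] levels of a point [N] levels below [x] is not above [x]. *)
have [g gN Mg] := marker_near (free_shift G ((0%R, (- Posz N)%R) : G) x).
have [||g' [g'0 Mg'] g'min] := @min_level
    [set g : G | (0 <= g.2)%R /\ M (free_shift G g^-1 x)] 0%R.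
- exists ((g * ((0%R, (- Posz N)%R) : G))^-1); rewrite -actM in Mg.
  by split; [rewrite level_inv level_mul /=; lia|rewrite invgK].
- by move=> h [].
exists g'; split => // h /andP[h0 hg] Mh; have := g'min h (conj h0 Mh).
by rewrite leNgt hg.
Qed.

Lemma next_marker_ex r : exists g, next_marker r g.
Proof.
(* Going up [N.+1] levels makes the nearby marker lie strictly above [r]. *)
have [g gN Mg] := marker_near (free_shift G ((0%R, Posz N.+1) : G) r).
have [||g' [g'0 Mg'] g'min] := @min_level
    [set g : G | (0 < g.2)%R /\ M (free_shift G g r)] 0%R.
- exists (g * ((0%R, Posz N.+1) : G)); rewrite -actM in Mg.
  by split=> //; rewrite level_mul /=; lia.
- by move=> h [/ltW].
exists g'; split => // h /andP[h0 hg] Mh; have := g'min h (conj h0 Mh).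
by rewrite leNgt hg.
Qed.

Lemma left_marker_uniq x g h : left_marker x g -> left_marker x h -> g = h.
Proof.
move=> [g0 Mg gmin] [h0 Mh hmin].
have gh : g.2 = h.2.
  have [lt|lt|//] := ltgtP g.2 h.2.
    by have := hmin g; rewrite g0 lt => /(_ isT).
  by have := gmin h; rewrite h0 lt => /(_ isT).
by apply: invg_inj; apply: (marker_uniq Mg Mh); rewrite !level_inv gh; lia.
Qed.

Lemma next_marker_uniq r g h : next_marker r g -> next_marker r h -> g = h.
Proof.
move=> [g0 Mg gmin] [h0 Mh hmin].
have gh : g.2 = h.2.
  have [lt|lt|//] := ltgtP g.2 h.2.
    by have := hmin g; rewrite g0 lt => /(_ isT).
  by have := gmin h; rewrite h0 lt => /(_ isT).
by apply: (marker_uniq Mg Mh); rewrite gh; lia.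
Qed.

Lemma next_marker_far r g : M r -> next_marker r g -> (N < `|g.2|)%N.
Proof.
move=> Mr [g0 Mg _]; rewrite ltnNge; apply/negP => gN.
have := @marker_uniq r 1 g; rewrite act1 => /(_ Mr Mg).
by move=> /(_ _)-g1; move: g0; rewrite -g1 //=; rewrite subr0.
Qed.

Definition position (x : free_part G) (d : semidirect e m * semidirect e m) : Prop :=
  left_marker x d.1 /\ next_marker (free_shift G d.1^-1 x) d.2.

Lemma position_lt x d : position x d -> (d.1.2 < d.2.2)%R.
Proof.
case: d => g h [/= [g0 Mg gmin] [h0 Mh _]]; rewrite ltNge; apply/negP => hg.
apply: (gmin (h * g^-1)^-1); last by rewrite invgK actM.
by rewrite level_inv level_mul level_inv; lia.
Qed.

Definition position_color (d : semidirect e m * semidirect e m) : 'I_K :=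
  psi d.2.1 `|d.2.2|%N d.1.1 `|d.1.2|%N.

Lemma position_colorE g h :
  position_color (g, h) = psi h.1 `|h.2|%N g.1 `|g.2|%N.
Proof. by []. Qed.

(** A horizontal edge stays within a level, where [psi] is injective. An ascending edge below the
    next marker stays in the strip, where the step condition applies. An ascending edge reaching
    that marker changes strips, and there both strips give the coloring [c0] seen from the
    marker. *)
Lemma position_color_step x y dx dy s : positive_gen s -> free_shift G s x = y ->
  position x dx -> position y dy -> position_color dx <> position_color dy.
Proof.
case: dx => g h sP sxy [xg rh] ydy.
have [g0 Mr gmin] : left_marker x g := xg.
have hN : next_marker (free_shift G g^-1 x) h := rh.
have gh : (g.2 < h.2)%R by exact: (@position_lt x (g, h) (conj xg rh)).
have [_ Mh hmin] := hN; have Lfar := next_marker_far Mr hN.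
have [psi0 psiL psi_inj psi_step] := psiP h.1 Lfar.
have dyE d : position y d -> dy = d.
  case: d dy ydy => g1 h1 [g2 h2] [/= y2 r2] [/= y1 r1].
  have e2 := left_marker_uniq y2 y1; rewrite e2 in r2.
  by rewrite e2 (next_marker_uniq r2 r1).
have yr (k : G) : free_shift G k^-1 y = free_shift G (k^-1 * (s * g)) (free_shift G g^-1 x).
  by rewrite -sxy -!actM -!mulgA mulgV mulg1.
have rsg : free_shift G (s * g)^-1 y = free_shift G g^-1 x by rewrite yr mulVg act1.
case: sP => [[s0 sj]|[s1 sj0 sj1]].
  have sgE : (s * g).1 = (s.1 + g.1)%R by rewrite mul_fst s0 twist0.
  have sg2 : (s * g).2 = g.2 by rewrite level_mul s0 add0r.
  have ysg : left_marker y (s * g).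
    split; [by rewrite sg2|by rewrite rsg|].
    move=> k; rewrite sg2 => kg; have := gmin (s^-1 * k).
    rewrite level_mul level_inv s0 oppr0 add0r => /(_ kg).
    by rewrite invgM invgK actM sxy.
  rewrite -rsg in hN; rewrite (dyE _ (conj ysg hN : position y (s * g, h))).
  have gL : (`|g.2| <= `|h.2|)%N by lia.
  rewrite !position_colorE sgE sg2 => /(psi_inj _ gL)/eqP.
  by rewrite -[X in X == _]add0r (inj_eq (addIr _)) eq_sym (negPf sj).
have sgE : (s * g).1 = (s.1 + twist e 1 g.1)%R by rewrite mul_fst s1.
have sg2 : (s * g).2 = (g.2 + 1)%R by rewrite level_mul s1 addrC.
have step : psi h.1 `|h.2|%N g.1 `|g.2|%N <> psi h.1 `|h.2|%N (s * g).1 `|g.2|.+1.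
  by rewrite sgE; apply: psi_step => //; lia.
have [lt|ge] := ltP (g.2 + 1)%R h.2.
  have ysg : left_marker y (s * g).
    split; [by rewrite sg2; lia|by rewrite rsg|].
    move=> k; rewrite sg2 yr => kg; apply: hmin.
    by rewrite level_mul level_inv sg2; lia.
  rewrite -rsg in hN; rewrite (dyE _ (conj ysg hN : position y (s * g, h))).
  rewrite !position_colorE sg2.
  by have -> : absz (g.2 + 1)%R = `|g.2|.+1 by lia.
(* The element of level 0 that carries the next marker to [y]. *)
set u : G := s * g * h^-1.
have u2 : u.2 = 0%R by rewrite /u level_mul sg2 level_inv; lia.
have uE : (s * g).1 = (u.1 + h.1)%R.
  by rewrite -[s * g](mulgVK h) -/u mul_fst u2 twist0.
have uy : free_shift G u^-1 y = free_shift G h (free_shift G g^-1 x).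
  by rewrite yr /u invgM invgK mulgVK.
have [h' h'N] := next_marker_ex (free_shift G u^-1 y).
have yu : left_marker y u.
  by split; [rewrite u2|rewrite uy|move=> k; rewrite u2; lia].
rewrite (dyE _ (conj yu h'N : position y (u, h'))).
have Mu : M (free_shift G u^-1 y) by rewrite uy.
have [psi0' _ _ _] := psiP h'.1 (next_marker_far Mu h'N).
rewrite !position_colorE u2 psi0' -psiL -uE.
have hE : `|g.2|.+1 = `|h.2|%N by lia.
by rewrite hE in step.
Qed.

(** The color depends only on the position, which takes countably many values, each on a Borel
    set. *)
Lemma markers_borel_colorable : borel_colorable (shift_graph G) K.
Proof.
have /choice[pos posP] x : exists d, position x d.
  have [g xg] := left_marker_ex x; have [h gh] := next_marker_ex (free_shift G g^-1 x).
  by exists (g, h).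
have pos_uniq x d : position x d -> pos x = d.
  case: d => g h [/= xg xh]; have [xg' xh'] := posP x.
  have e1 := left_marker_uniq xg' xg; rewrite e1 in xh'.
  by rewrite [pos x]surjective_pairing e1 (next_marker_uniq xh' xh).
exists (position_color \o pos).
  move=> x y [_ [s [sP|sP] sxy]] /=.
    exact: position_color_step sP sxy (posP x) (posP y).
  apply/nesym; apply: position_color_step sP _ (posP y) (posP x).
  by rewrite -sxy -actM mulVg act1.
move=> A.
have -> : (position_color \o pos) @^-1` A =
    \bigcup_d ([set x | position x d] `&` [set _ | A (position_color d)]).
  apply/seteqP; split=> [x Ax|x [d _ [/pos_uniq xd Ad]]]; last by rewrite /preimage /= xd.
  by exists (pos x) => //; split => //; exact: posP.
apply: borel_bigcup => -[g h]; apply: borelI; last exact: borel_cst.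
have bM (k : G) : borel [set x | M (free_shift G k x)] by exact: borel_act.
have bl : borel [set x | left_marker x g].
  have -> : [set x | left_marker x g] = [set _ | (0 <= g.2)%R] `&`
      [set x | M (free_shift G g^-1 x)] `&` \bigcap_(k : semidirect e m)
      ([set _ | ~ (0 <= k.2 < g.2)%R] `|` ~` [set x | M (free_shift G k^-1 x)]).
    apply/seteqP; split=> [x [g0 Mx gmin]|x [[g0 Mx] gmin]]; split=> //.
      move=> k _; have [/gmin nM|/negP nk] := boolP (0 <= k.2 < g.2)%R; last by left.
      by right; exact: nM.
    by move=> k k0; case: (gmin k I).
  apply: borelI; first by apply: borelI; [exact: borel_cst|exact: bM].
  by apply: borel_bigcap => k; apply: borelU; [exact: borel_cst|apply: borelC; exact: bM].
apply: (borelI bl); apply: (@borel_act G g^-1 [set r | next_marker r h]).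
have -> : [set r | next_marker r h] = [set _ | (0 < h.2)%R] `&`
    [set x | M (free_shift G h x)] `&` \bigcap_(k : semidirect e m)
    ([set _ | ~ (0 < k.2 < h.2)%R] `|` ~` [set x | M (free_shift G k x)]).
  apply/seteqP; split=> [x [g0 Mx gmin]|x [[g0 Mx] gmin]]; split=> //.
    move=> k _; have [/gmin nM|/negP nk] := boolP (0 < k.2 < h.2)%R; last by left.
    by right; exact: nM.
  by move=> k k0; case: (gmin k I).
apply: borelI; first by apply: borelI; [exact: borel_cst|exact: bM].
by apply: borel_bigcap => k; apply: borelU; [exact: borel_cst|apply: borelC; exact: bM].
Qed.

End Strips.

Lemma strips_borel_colorable (e : bool) (m K N : nat) (c0 : 'I_m.+3 -> 'I_K) :
  (forall i' L, (N < L)%N -> exists psi, strip_coloring e c0 i' L psi) ->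
  borel_colorable (shift_graph (sd_marked e m)) K.
Proof.
move=> strips.
have /choice[psi psiP] (p : 'I_m.+3 * nat) :
    exists psi, (N < p.2)%N -> strip_coloring e c0 p.1 p.2 psi.
  (* Strips of length at most [N] get an arbitrary value; they do not occur between markers. *)
  have [Np|_] := boolP (N < p.2)%N; last by exists (fun i _ => c0 i).
  by have [psi psiP] := strips p.1 p.2 Np; exists psi.
have [||M [bM Mi Mm]] := @borel_marker _ _ (@sd_enum_surj e m) (near_levels e m N).
- by rewrite mem_near_levels eqxx.
- move=> h; rewrite !mem_near_levels invg_eq1 => /andP[-> hN] /=.
  by rewrite abszN.
apply: (@markers_borel_colorable e m K N c0 (fun i' L => psi (i', L)) _ M bM Mi Mm).
by move=> i' L NL; exact: (psiP (i', L)).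
Qed.

Lemma untwisted_strip m (i' : 'I_m.+3) (L : nat) : (m.+3 < L)%N ->
  exists psi, strip_coloring false id i' L psi.
Proof.
(* The phase advances by one per level until it reaches [i'], then stays. Across a step the color
   changes by [j] or [j - 1], both nonzero. *)
move=> mL; exists (fun i n => i - (minn n i')%:R)%R; split.
- by move=> i; rewrite min0n subr0.
- move=> i; have -> : minn L i' = i' by have := ltn_ord i'; lia.
  by rewrite natr_Zp addrK.
- by move=> n _ i j /addIr.
- move=> n i j _ j0 j1 /=; have -> : twist false 1 i = i by [].
  move=> /eqP.
  have [ni|ni] : (i' <= n)%N \/ (n < i')%N by lia.
    have -> : minn n.+1 i' = minn n i' by lia.
    by rewrite (inj_eq (addIr _)) -[X in X == _]add0r (inj_eq (addIr _)) eq_sym (negPf j0).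
  have -> : minn n.+1 i' = (minn n i').+1 by lia.
  rewrite -natr1 opprD addrA addrAC (inj_eq (addIr _)) addrAC.
  by rewrite -[X in X == _]add0r (inj_eq (addIr _)) eq_sym subr_eq0 (negPf j1).
Qed.

(** * Joining two injective colorings by means of a spare color *)

Section Recoloring.
Variables A C : finType.
Hypothesis AC : (#|A| < #|C|)%N.
Implicit Types f g h : A -> C.

(** A color present at two consecutive times stays at the same vertex. *)
Definition recoloring (L : nat) f g : Prop := exists ph : nat -> A -> C,
  [/\ ph 0%N = f, ph L = g, forall n, (n <= L)%N -> injective (ph n)
    & forall n u v, (n < L)%N -> u != v -> ph n u <> ph n.+1 v].

Lemma recoloring_cst L f : injective f -> recoloring L f f.
Proof.
move=> fi; exists (fun=> f); split => // n u v _ uv /fi uv'.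
by rewrite uv' eqxx in uv.
Qed.

Lemma recoloring_trans L L' f g h :
  recoloring L f g -> recoloring L' g h -> recoloring (L + L') f h.
Proof.
move=> [p [p0 pL pi ps]] [q [q0 qL qi qs]].
exists (fun n => if (n <= L)%N then p n else q (n - L)%N); split.
- by rewrite leq0n.
- case: leqP => [LL|_]; last by rewrite addKn.
  have L'0 : L' = 0%N by lia.
  by rewrite L'0 addn0 pL -q0 -qL L'0.
- by move=> n nL; case: leqP => [/pi//|Ln]; apply: qi; lia.
- move=> n u v nL uv; have [nL'|nL'] := leqP n.+1 L.
    by rewrite (ltnW nL'); exact: ps.
  have qS : q (n.+1 - L)%N = q (n - L).+1 by congr q; lia.
  rewrite qS; case: leqP => [nL2|nL2]; last by apply: qs => //; lia.
  have nE : n = L by lia.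
  by rewrite nE pL -q0 subnn; apply: qs => //; lia.
Qed.

Definition recolor f (v : A) (b : C) : A -> C := fun u => if u == v then b else f u.

Lemma recolor_inj f v b : injective f -> (forall u, f u <> b) -> injective (recolor f v b).
Proof.
move=> fi fb u w; rewrite /recolor; case: eqP => [->|uv]; case: eqP => [->|wv] //.
- by move=> /esym/fb.
- by move=> /fb.
- exact: fi.
Qed.

Lemma recoloring_recolor f v b : injective f -> (forall u, f u <> b) ->
  recoloring 1 f (recolor f v b).
Proof.
move=> fi fb; exists (fun n => if n is 0 then f else recolor f v b); split => //.
- by move=> [|n] _; [exact: fi|exact: recolor_inj].
- move=> [|//] u w _ uw; rewrite /recolor; case: eqP => // _ /fi uw'.
  by rewrite uw' eqxx in uw.
Qed.

Lemma spare_color f : injective f -> exists b, forall u, f u <> b.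
Proof.
move=> fi; have /subsetPn[b _ bf] : ~~ (C \subset codom f).
  by apply: contraL AC => /subset_leq_card; rewrite card_codom // -leqNgt.
by exists b => u fu; rewrite -fu codom_f in bf.
Qed.

(** Vertices are corrected one at a time, in two steps each: a vertex [w] holding the wanted color
    is first moved to a spare color, then [v] is recolored. Corrected vertices are not disturbed,
    since [g] is injective. If the wanted color is free, a constant step keeps the length at 2. *)
Lemma recoloring_agree f g (s : seq A) : injective f -> injective g -> uniq s ->
  exists h, [/\ injective h, {in s, h =1 g} & recoloring (size s).*2 f h].
Proof.
move=> fi gi; elim: s => [|v s IH] /=.
  by move=> _; exists f; split => //; exact: recoloring_cst.
move=> /andP[vs /IH[h [hi hg fh]]].
suff [h' [h'i h'g hh']] : exists h', [/\ injective h', {in v :: s, h' =1 g}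
    & recoloring 2 h h'].
  by exists h'; split => //; rewrite doubleS -addn2; exact: recoloring_trans hh'.
have [[w hw]|nw] := pselect (exists w, h w = g v); last first.
  have hb u : h u <> g v by move=> hu; apply: nw; exists u.
  exists (recolor h v (g v)); split; first exact: recolor_inj.
    move=> u; rewrite inE /recolor => /predU1P[->|us]; first by rewrite eqxx.
    by case: eqP => [->//|_]; exact: hg.
  apply: (@recoloring_trans 1 1 _ _ _ (recoloring_recolor v hi hb)).
  by apply: recoloring_cst; exact: recolor_inj.
have [b hb] := spare_color hi.
have h1i : injective (recolor h w b) by exact: recolor_inj.
have h1b u : recolor h w b u <> g v.
  rewrite /recolor -hw; case: eqP => [_ /esym/hb//|uw /hi]; exact: uw.
have ws : w \notin s.
  by apply/negP => /[dup] ws /hg; rewrite hw => /gi vw; rewrite vw ws in vs.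
exists (recolor (recolor h w b) v (g v)); split; first exact: recolor_inj.
  move=> u; rewrite inE {1}/recolor => /predU1P[->|us]; first by rewrite eqxx.
  case: eqP => [->//|_]; rewrite /recolor; case: eqP => [uw|_]; last exact: hg.
  by rewrite -uw us in ws.
exact: (@recoloring_trans 1 1 _ _ _ (recoloring_recolor w hi hb) (recoloring_recolor v h1i h1b)).
Qed.

Lemma recoloring_ex f g L : injective f -> injective g -> (#|A|.*2 <= L)%N ->
  recoloring L f g.
Proof.
move=> fi gi AL; have [h [hi hg fh]] := recoloring_agree fi gi (enum_uniq A).
have -> : g = h by apply/funext => u; rewrite hg // mem_enum.
rewrite -(subnKC AL); apply: recoloring_trans (recoloring_cst _ hi).
by rewrite cardE.
Qed.

End Recoloring.

Lemma spare_color_strip e m (i' : 'I_m.+3) (L : nat) : ((m.+3).*2 < L)%N ->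
  exists psi, strip_coloring e (widen_ord (leqnSn m.+3)) i' L psi.
Proof.
move=> mL; pose c0 : 'I_m.+3 -> 'I_m.+4 := widen_ord (leqnSn m.+3).
have c0i : injective c0 by move=> i j [] ij; exact: val_inj.
have ti n : injective (@twist e m n) by exact: inv_inj (@twistK e m n).
have AC : (#|'I_m.+3| < #|'I_m.+4|)%N by rewrite !card_ord.
(* In the coordinate [twist e n i] on level [n], the position [j = 0] becomes vertical, so a
   recoloring of length [L] suffices. Its target is [c0] seen from the next marker. *)
have [|||ph [ph0 phL phi phs]] := @recoloring_ex 'I_m.+3 'I_m.+4 AC c0
    (fun v => c0 (twist e (Posz L) v - i')%R) L.
- exact: c0i.
- by move=> u v /c0i/addIr/ti.
- by rewrite card_ord; exact: ltnW.
exists (fun i n => ph n (twist e (Posz n) i)); split.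
- by move=> i; rewrite ph0 twist0.
- by move=> i; rewrite phL twistK addrK.
- by move=> n nL i j /(phi n nL)/ti.
- move=> n i j nL j0 _; apply: phs => //.
  have -> : Posz n.+1 = (Posz n + 1)%R by lia.
  rewrite twistD (inj_eq (@ti _)) twist_add twistK.
  rewrite -[X in X == _]add0r (inj_eq (addIr _)) eq_sym.
  by rewrite -(twist_at0 e m 1) (inj_eq (@ti _)).
Qed.

(** * The chromatic numbers of the two marked groups *)

Theorem theorem1 (k : nat) (hk : 3 <= k) :
  exists Gam Del : marked_group,
    [/\ graph_iso (Cay Gam) (Cay Del),
        [/\ borel_chromatic_number (shift_graph Gam) k,
            chromatic_number (shift_graph Gam) k,
            chromatic_number (shift_graph Del) k,
            chromatic_number (Cay Gam) k
          & chromatic_number (Cay Del) k]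
      & borel_chromatic_number (shift_graph Del) k.+1].
Proof.
case: k hk => [|[|[|m]]] // _.
exists (sd_marked false m), (sd_marked true m).
have iso := cayley_iso m.
have CG := cay_untwisted_colorable m.
have CD := graph_iso_colorable iso CG.
split => //; first split.
- split; first exact: strips_borel_colorable (@untwisted_strip m).
  by move=> j /borel_colorable_colorable; exact: shift_lower.
- by split; [exact: shift_colorable|exact: shift_lower].
- by split; [exact: shift_colorable|exact: shift_lower].
- by split=> //; exact: cay_lower.
- by split=> //; exact: cay_lower.
- split; first exact: strips_borel_colorable (@spare_color_strip true m).
  (* The clique bound gives at least [m.+3] colors, and equality is excluded by the reversal of the
     cyclic order. *)
  move=> j bj; have := shift_lower (borel_colorable_colorable bj).
  rewrite leq_eqVlt => /predU1P[je|//]; move: bj; rewrite -je => -[c cP bc].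
  by case: (no_borel_coloring cP bc).
Qed.
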